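(* Let $d\ge2$ and let $A,B,A_1,A_2$ be $d$-dimensional systems. Then \[\max_{\Lambda}\mathcal{P}(\Lambda)=\mathcal{P}(\Upsilon^d_{A\to A_1A_2}),\] where the maximum is over all symmetric broadcasting channels $\Lambda_{A\to A_1A_2}$ (and this common value equals $\sqrt{(d+1)/(2d)}$ as shown by the paper's accompanying computations, though the claim is the equality of maxima).
   Context: Fidelity: $F(\rho,\sigma)=\mathrm{tr}\sqrt{\sqrt{\rho}\sigma\sqrt{\rho}}$. A quantum channel $\Lambda_{A\to A_1A_2}$ is a symmetric broadcasting channel if $\Lambda(\rho)=W\Lambda(\rho)W^\dagger$ for all states $\rho$ on $A$, where $W$ is the swap unitary on $A_1A_2$. The unilocal broadcasting power of such a channel is \[\mathcal{P}(\Lambda)=\inf_{\rho_{AB}}F\big(\rho_{AB},\ \mathrm{tr}_{A_2}(\Lambda\otimes\mathrm{id}_B)(\rho_{AB})\big),\] the infimum over all states on $AB$, with $A_1$ identified with $A$. $\Upsilon^d_{A\to A_1A_2}$ is the channel whose Choi matrix $J=(\mathrm{id}_A\otimes\Upsilon)(\sum_{i,j}|ii\rangle\langle jj|)$ equals $\sum_{i=0}^{d-1}|v_i\rangle\langle v_i|$ on $AA_1A_2$, with $|v_i\rangle=\frac{1}{\sqrt{2(d+1)}}\big(2|i\rangle\otimes|ii\rangle+\sum_{j\ne i}|j\rangle\otimes(|ij\rangle+|ji\rangle)\big)$; the action is $\Upsilon(\rho)=\mathrm{tr}_A(J^{T_A}\rho)$ (it is a symmetric broadcasting channel). *)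

(* Defs.v *)
From HB Require Import structures.
From mathcomp Require Import all_boot all_order all_algebra.
From mathcomp Require Import complex mxtens.
From mathcomp Require Import boolp classical_sets reals.

Set Implicit Arguments.
Unset Strict Implicit.
Unset Printing Implicit Defensive.

Import Order.TTheory GRing.Theory Num.Theory.
Local Open Scope ring_scope.

Section QuantumDefs.
Variable R : realType.
Local Notation C := (R[i]).

Definition adjmx m n (A : 'M[C]_(m, n)) : 'M[C]_(n, m) := (map_mx conjc A)^T.

(* index of the basis vector |i>|j> in the tensor product (first factor major),
   the convention of mxtens / tensmx *)
Definition idx m n (i : 'I_m) (j : 'I_n) : 'I_(m * n) := mxtens_index (i, j).

Definition psd n (X : 'M[C]_n) : Prop :=
  forall v : 'cV[C]_n,
    complex.Im ((adjmx v *m X *m v) 0 0) = 0 /\ 0 <= complex.Re ((adjmx v *m X *m v) 0 0).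

Definition is_state n (X : 'M[C]_n) : Prop := psd X /\ \tr X = 1.

(* the positive semidefinite square root (unique when X is psd) *)
Definition msqrt n (X : 'M[C]_n) : 'M[C]_n :=
  xget 0 [set S : 'M[C]_n | psd S /\ S *m S = X].

Definition fidelity n (rho sigma : 'M[C]_n) : R :=
  complex.Re (\tr (msqrt (msqrt rho *m sigma *m msqrt rho))).

Definition blk2 m n (X : 'M[C]_(m * n)) (k l : 'I_n) : 'M[C]_m :=
  \matrix_(i, j) X (idx i k) (idx j l).

Definition blk1 m n (X : 'M[C]_(m * n)) (i j : 'I_m) : 'M[C]_n :=
  \matrix_(p, q) X (idx i p) (idx j q).

(* Lambda (x) id_n applied to X on A (x) B, B of dimension n;
   the output lives on (A1 A2) (x) B *)
Definition ext_id d n (L : 'M[C]_d -> 'M[C]_(d * d)) (X : 'M[C]_(d * n))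
  : 'M[C]_(d * d * n) :=
  \sum_(k < n) \sum_(l < n) (L (blk2 X k l) *t (delta_mx k l : 'M[C]_n)).

Definition ptr_mid a b c (Y : 'M[C]_(a * b * c)) : 'M[C]_(a * c) :=
  \sum_(i < a) \sum_(i' < a) \sum_(k < c) \sum_(k' < c)
    (\sum_(j < b) Y (idx (idx i j) k) (idx (idx i' j) k'))
      *: ((delta_mx i i' : 'M[C]_a) *t (delta_mx k k' : 'M[C]_c)).

Definition ptr1 a b (Y : 'M[C]_(a * b)) : 'M[C]_b :=
  \matrix_(p, q) \sum_(i < a) Y (idx i p) (idx i q).

Definition ptranspose1 a b (X : 'M[C]_(a * b)) : 'M[C]_(a * b) :=
  \sum_(i < a) \sum_(j < a) ((delta_mx j i : 'M[C]_a) *t blk1 X i j).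

Definition is_channel d (L : 'M[C]_d -> 'M[C]_(d * d)) : Prop :=
  [/\ (forall (c : C) (X Y : 'M[C]_d), L (c *: X + Y) = c *: L X + L Y),
      (forall (n : nat) (X : 'M[C]_(d * n)), psd X -> psd (ext_id L X)) &
      (forall X : 'M[C]_d, \tr (L X) = \tr X)].

Definition swapW d : 'M[C]_(d * d) :=
  \sum_(i < d) \sum_(j < d) ((delta_mx i j : 'M[C]_d) *t (delta_mx j i : 'M[C]_d)).

Definition sym_broadcast d (L : 'M[C]_d -> 'M[C]_(d * d)) : Prop :=
  is_channel L /\
  forall rho : 'M[C]_d, is_state rho ->
    L rho = swapW d *m L rho *m adjmx (swapW d).

Definition broadcast_power d (L : 'M[C]_d -> 'M[C]_(d * d)) : R :=
  inf ((fun rho : 'M[C]_(d * d) => fidelity rho (ptr_mid (ext_id L rho)))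
         @` [set rho | is_state rho]).

Definition ket d (i : 'I_d) : 'cV[C]_d := delta_mx i 0.

Definition ups_v d (i : 'I_d) : 'cV[C]_(d * (d * d)) :=
  real_complex R ((Num.sqrt (2 * (d%:R + 1)))^-1) *:
    (2 *: (ket i *t (ket i *t ket i))
     + \sum_(j < d | j != i) (ket j *t (ket i *t ket j + ket j *t ket i))).

Definition ups_choi d : 'M[C]_(d * (d * d)) :=
  \sum_(i < d) (ups_v i *m adjmx (ups_v i)).

Definition Upsilon d (rho : 'M[C]_d) : 'M[C]_(d * d) :=
  ptr1 (ptranspose1 (ups_choi d) *m (rho *t (1%:M : 'M[C]_(d * d)))).

End QuantumDefs.

(* Main.v *)
(** The common value of the two sides is sqrt c with c = (d+1)/(2d).

    Upsilon is the map rho |-> (1/(2(d+1))) sum_i K_i rho K_i^* with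
    K_i = sum_j (|ij> + |ji>)<j|, so tr_{A2} (Upsilon (x) id) X equals
    ((d+2) X + 1 (x) X_B) / (2(d+1)).  Since X <= d (1 (x) X_B), this marginal
    is at least c X, and operator monotonicity of the square root gives
    F(X, marginal) >= F(X, c X) = sqrt c.

    Conversely, let Phi be the maximally entangled state and J = (L (x) id) Phi
    for a symmetric broadcasting channel L.  Then F^2 = tr (J Phi_{A1 B}), which
    by symmetry is tr (J (Phi_{A1 B} + Phi_{A2 B})) / 2.  The ranges of these two
    projections V V^* and U U^* satisfy V^* U = 1/d, so their sum is at most
    1 + 1/d and F^2 <= (1 + 1/d) / 2 = c. *)
Require Import Defs.
From HB Require Import structures.
From mathcomp Require Import all_boot all_order all_algebra.
From mathcomp Require Import complex mxtens spectral ring.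
From mathcomp Require Import boolp classical_sets reals.

Set Implicit Arguments.
Unset Strict Implicit.
Unset Printing Implicit Defensive.

Import Order.TTheory GRing.Theory Num.Theory.
Local Open Scope ring_scope.

(** * Positive semidefinite (psd) matrices, their square roots, and bounds on the fidelity *)

Section PositiveSemidefinite.
Variable R : realType.
Local Notation C := (R[i]).

Lemma adjmxE m n (A : 'M[C]_(m, n)) i j : adjmx A i j = (A j i)^*.
Proof. by rewrite !mxE. Qed.

Lemma adjmx_sesqui m n (A : 'M[C]_(m, n)) : adjmx A = (A ^t*)%sesqui.
Proof. by apply/matrixP => i j; rewrite !mxE. Qed.

Lemma adjmxK m n (A : 'M[C]_(m, n)) : adjmx (adjmx A) = A.
Proof. by apply/matrixP => i j; rewrite !adjmxE conjCK. Qed.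

Lemma adjmxM m n p (A : 'M[C]_(m, n)) (B : 'M[C]_(n, p)) :
  adjmx (A *m B) = adjmx B *m adjmx A.
Proof. by rewrite /adjmx map_mxM trmx_mul. Qed.

Lemma adjmxD m n (A B : 'M[C]_(m, n)) : adjmx (A + B) = adjmx A + adjmx B.
Proof. by apply/matrixP => i j; rewrite adjmxE !mxE rmorphD. Qed.

Lemma adjmxN m n (A : 'M[C]_(m, n)) : adjmx (- A) = - adjmx A.
Proof. by apply/matrixP => i j; rewrite adjmxE !mxE rmorphN. Qed.

Lemma adjmxB m n (A B : 'M[C]_(m, n)) : adjmx (A - B) = adjmx A - adjmx B.
Proof. by rewrite adjmxD adjmxN. Qed.

Lemma adjmxZ m n a (A : 'M[C]_(m, n)) : adjmx (a *: A) = a^* *: adjmx A.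
Proof. by apply/matrixP => i j; rewrite adjmxE !mxE rmorphM. Qed.

Lemma adjmx1 n : adjmx (1%:M : 'M[C]_n) = 1%:M.
Proof. by apply/matrixP => i j; rewrite adjmxE !mxE rmorph_nat eq_sym. Qed.

Lemma adjmx_delta m n i j :
  adjmx (delta_mx i j : 'M[C]_(m, n)) = delta_mx j i.
Proof. by apply/matrixP => k l; rewrite adjmxE !mxE rmorph_nat andbC. Qed.

Lemma ge0_ReIm (z : C) :
  (0 <= z) <-> complex.Im z = 0 /\ 0 <= complex.Re z.
Proof.
by rewrite lecE /=; split => [/andP[/eqP -> ->] | [-> ->]]; rewrite ?eqxx.
Qed.

Lemma psdP n (X : 'M[C]_n) :
  psd X <-> forall v : 'cV[C]_n, 0 <= (adjmx v *m X *m v) 0 0.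
Proof. by split=> h v; apply/ge0_ReIm; apply: h. Qed.

Lemma form_delta n (X : 'M[C]_n) i j :
  (adjmx (@delta_mx C n 1 i 0) *m X *m @delta_mx C n 1 j 0) 0 0 = X i j.
Proof. by rewrite adjmx_delta -rowE -colE !mxE. Qed.

(** At [v = e_k + a e_l] the diagonal terms vanish, leaving [a^* N_lk + a N_kl = 0]. The choices
    [a = 1] and [a = i] give [N_kl = - N_lk] and [N_kl = N_lk]. *)
Lemma form_polarization n (N : 'M[C]_n) :
  (forall v : 'cV[C]_n, (adjmx v *m N *m v) 0 0 = 0) -> N = 0.
Proof.
move=> N0; apply/matrixP => k l; rewrite mxE.
have D i : N i i = 0 by rewrite -(form_delta N) N0.
have addE (A B : 'M[C]_1) : (A + B) 0 0 = A 0 0 + B 0 0 by rewrite mxE.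
have scaleE a (A : 'M[C]_1) : (a *: A) 0 0 = a * A 0 0 by rewrite mxE.
have E a : a^* * N l k + a * N k l = 0.
  have := N0 (delta_mx k 0 + a *: delta_mx l 0).
  rewrite adjmxD adjmxZ mulmxDl mulmxDr !mulmxDl.
  rewrite -!(scalemxAl, scalemxAr).
  rewrite !addE !scaleE !form_delta !D.
  by rewrite !mulr0 !addr0 add0r addrC.
have := E 1; have := E 'i; rewrite conjCi rmorph1 !mul1r mulNr.
move=> /eqP; rewrite addrC subr_eq0 => /eqP/(mulfI (neq0Ci _)) -> /eqP.
by rewrite -mulr2n mulrn_eq0 => /= /eqP.
Qed.

(** The quadratic form is real, so [X] and its adjoint have the same form and polarization
    identifies them. *)
Lemma psd_adjmx n (X : 'M[C]_n) : psd X -> adjmx X = X.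
Proof.
move=> /psdP Xp; apply/eqP; rewrite -subr_eq0; apply/eqP.
apply: form_polarization => v; rewrite mulmxBr mulmxBl mxE [X in _ + X]mxE.
have -> : adjmx v *m adjmx X *m v = adjmx (adjmx v *m X *m v).
  by rewrite !adjmxM adjmxK mulmxA.
by rewrite adjmxE (CrealP (ger0_real (Xp v))) subrr.
Qed.

Lemma psd_congr m n (X : 'M[C]_n) (T : 'M[C]_(n, m)) :
  psd X -> psd (adjmx T *m X *m T).
Proof.
move=> /psdP Xp; apply/psdP => v; have := Xp (T *m v).
by rewrite adjmxM !mulmxA.
Qed.

Lemma psd0 n : psd (0 : 'M[C]_n).
Proof. by apply/psdP => v; rewrite mulmx0 mul0mx mxE. Qed.

Lemma psdD n (X Y : 'M[C]_n) : psd X -> psd Y -> psd (X + Y).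
Proof.
move=> /psdP Xp /psdP Yp; apply/psdP => v.
by rewrite mulmxDr mulmxDl mxE addr_ge0.
Qed.

Lemma psdZ n a (X : 'M[C]_n) : 0 <= a -> psd X -> psd (a *: X).
Proof.
move=> a0 /psdP Xp; apply/psdP => v.
by rewrite -scalemxAr -scalemxAl mxE mulr_ge0.
Qed.

Lemma psd_sum n (I : finType) (P : pred I) (F : I -> 'M[C]_n) :
  (forall i, P i -> psd (F i)) -> psd (\sum_(i | P i) F i).
Proof. by move=> h; apply: big_ind; [exact: psd0 | exact: psdD | exact: h]. Qed.

Lemma psd_diag n (D : 'rV[C]_n) : (forall i, 0 <= D 0 i) -> psd (diag_mx D).
Proof.
move=> D0; apply/psdP => v; rewrite mxE sumr_ge0 // => i _.
rewrite mul_mx_diag mxE adjmxE mulrC mulrA mulr_ge0 //.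
by rewrite mul_conjC_ge0.
Qed.

Lemma psd1 n : psd (1%:M : 'M[C]_n).
Proof.
by rewrite -diag_const_mx; apply: psd_diag => i; rewrite mxE.
Qed.

Lemma psd_gram m n (T : 'M[C]_(m, n)) : psd (adjmx T *m T).
Proof. by have := psd_congr T (@psd1 m); rewrite mulmx1. Qed.

Lemma psd_cogram m n (T : 'M[C]_(m, n)) : psd (T *m adjmx T).
Proof. by have := psd_gram (adjmx T); rewrite adjmxK. Qed.

Lemma psd_tr_ge0 n (X : 'M[C]_n) : psd X -> 0 <= \tr X.
Proof. by move=> /psdP Xp; apply: sumr_ge0 => i _; rewrite -(form_delta X). Qed.

Lemma psd_antisym n (X Y : 'M[C]_n) : psd (X - Y) -> psd (Y - X) -> X = Y.
Proof.
move=> /psdP h1 /psdP h2; apply/eqP; rewrite -subr_eq0; apply/eqP.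
apply: form_polarization => v; apply/eqP; rewrite eq_le h1 andbT.
by have := h2 v; rewrite -(opprB X Y) mulmxN mulNmx mxE oppr_ge0.
Qed.

Lemma hermitian_spectral n (H : 'M[C]_n) : adjmx H = H ->
  exists (U : 'M[C]_n) (D : 'rV[C]_n),
    U *m adjmx U = 1%:M /\ H = adjmx U *m diag_mx D *m U.
Proof.
move=> Hh; exists (spectralmx H), (spectral_diag H).
have Uu := spectral_unitarymx H; rewrite !adjmx_sesqui; split.
  exact/unitarymxP.
rewrite -(invmx_unitary Uu); apply/orthomx_spectralP/normalmxP.
by rewrite -adjmx_sesqui Hh.
Qed.

(** The root is taken on the eigenvalues, which are diagonal entries of [U X U^*] and hence
    nonnegative. *)
Lemma psd_sqrt_exists n (X : 'M[C]_n) :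
  psd X -> exists S : 'M[C]_n, psd S /\ S *m S = X.
Proof.
move=> Xp; have [U [D [UU XE]]] := hermitian_spectral (psd_adjmx Xp).
have D0 i : 0 <= D 0 i.
  have /psdP/(_ (delta_mx i 0)) := psd_congr (adjmx U) Xp.
  rewrite form_delta adjmxK XE !mulmxA UU mul1mx -mulmxA UU mulmx1.
  by rewrite mxE eqxx mulr1n.
pose E := diag_mx (map_mx sqrtC D).
exists (adjmx U *m E *m U); split.
  by apply/psd_congr/psd_diag => i; rewrite mxE sqrtC_ge0.
rewrite XE !mulmxA -(mulmxA _ U (adjmx U)) UU mulmx1 -(mulmxA _ E E).
congr (_ *m _ *m _); rewrite mulmx_diag; congr diag_mx.
by apply/rowP => i; rewrite !mxE -expr2 sqrtCK.
Qed.

(* With H = S - T and H v = a v, the identity S^2 - T^2 = S H + H T gives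
   0 <= a (<v, S v> + <v, T v>), where a = <v, S v> - <v, T v>. *)
Lemma psd_sqr_monotone n (S T : 'M[C]_n) :
  psd S -> psd T -> psd (S *m S - T *m T) -> psd (S - T).
Proof.
move=> Sp Tp STp.
have Hh : adjmx (S - T) = S - T by rewrite adjmxB !psd_adjmx.
have [U [D [UU HE]]] := hermitian_spectral Hh.
(* It suffices that each eigenvalue of [S - T] is nonnegative; [v] is a unit eigenvector for the
   eigenvalue [D 0 i]. *)
rewrite HE; apply/psd_congr/psd_diag => i.
pose v := adjmx U *m delta_mx i 0 : 'cV[C]_n.
have vv : adjmx v *m v = 1%:M.
  rewrite /v adjmxM adjmxK mulmxA -(mulmxA _ U) UU mulmx1 adjmx_delta.
  by rewrite mul_delta_mx; apply/matrixP => k l; rewrite !mxE !ord1.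
have Hv : (S - T) *m v = D 0 i *: v.
  rewrite HE /v mulmxA -(mulmxA _ U) UU mulmx1 -mulmxA.
  suff -> : diag_mx D *m delta_mx i 0 = D 0 i *: delta_mx i 0 :> 'cV[C]_n.
    by rewrite scalemxAr.
  apply/matrixP => k l; rewrite mul_diag_mx !mxE.
  by case: eqP => [->|]; rewrite ?mulr0.
clearbody v.
set a : C := (adjmx v *m S *m v) 0 0; set b : C := (adjmx v *m T *m v) 0 0.
have a0 : 0 <= a by move/psdP: Sp; apply.
have b0 : 0 <= b by move/psdP: Tp; apply.
have Dab : D 0 i = a - b.
  have -> : a - b = (adjmx v *m (S - T) *m v) 0 0.
    by rewrite mulmxBr mulmxBl [RHS]mxE [X in _ = _ + X]mxE.
  by rewrite -mulmxA Hv -scalemxAr vv !mxE mulr1.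
have vH : adjmx v *m (S - T) = D 0 i *: adjmx v.
  rewrite -{1}Hh -adjmxM Hv adjmxZ; congr (_ *: _).
  by apply/CrealP; rewrite Dab rpredB ?ger0_real.
(* Here [a] and [b] are the forms of [S] and [T] at [v], and the eigenvalue is [a - b]. As both are
   nonnegative, [b <= a] reduces to [b^2 <= a^2], and [a^2 - b^2] is the form of [S^2 - T^2] at
   [v]. *)
rewrite Dab subr_ge0 -(ler_sqr b0 a0) -subr_ge0.
have /psdP/(_ v) := STp; congr (0 <= _).
have -> : S *m S - T *m T = S *m (S - T) + (S - T) *m T.
  by rewrite mulmxBr mulmxBl addrA subrK.
rewrite mulmxDr mulmxDl -!mulmxA Hv !mulmxA vH -scalemxAr -!scalemxAl.
rewrite mxE [X in X + _]mxE [X in _ + X]mxE -/a -/b Dab. ring.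
Qed.

(** When [X] has no psd root, [msqrt X] is the default [0], again psd. *)
Lemma psd_msqrt n (X : 'M[C]_n) : psd (msqrt X).
Proof.
rewrite /msqrt; case: xgetP => [S _ []//|_]; exact: psd0.
Qed.

Lemma msqrtK n (X : 'M[C]_n) : psd X -> msqrt X *m msqrt X = X.
Proof. by move=> /psd_sqrt_exists h; case: (xgetPex 0 h). Qed.

(** Two psd roots have the same square, so monotonicity orders them both ways. *)
Lemma msqrt_unique n (S : 'M[C]_n) : psd S -> msqrt (S *m S) = S.
Proof.
move=> Sp.
have E : msqrt (S *m S) *m msqrt (S *m S) = S *m S.
  by apply: msqrtK; rewrite -{1}(psd_adjmx Sp); apply: psd_gram.
have Mp := psd_msqrt (S *m S).
by apply: psd_antisym; [apply: (psd_sqr_monotone Mp Sp) |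
  apply: (psd_sqr_monotone Sp Mp)]; rewrite E subrr; apply: psd0.
Qed.

(** By cyclicity the trace is that of [r Y r] with [r = msqrt X], a congruence of [Y]. *)
Lemma psd_mxtrace_mul_ge0 n (X Y : 'M[C]_n) :
  psd X -> psd Y -> 0 <= \tr (X *m Y).
Proof.
move=> Xp Yp; rewrite -(msqrtK Xp) -mulmxA mxtrace_mulC.
apply: psd_tr_ge0; rewrite -{1}(psd_adjmx (psd_msqrt X)).
exact/psd_congr.
Qed.

Lemma fidelity_ge0 n (rho sigma : 'M[C]_n) : 0 <= fidelity rho sigma.
Proof.
by have /ge0_ReIm[] := psd_tr_ge0 (psd_msqrt (msqrt rho *m sigma *m msqrt rho)).
Qed.

(** With [r = msqrt rho], the matrix [r sigma r] dominates [c r rho r], which is the square of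
    [sqrt c rho]. Monotonicity of the root and [tr rho = 1] give the bound. *)
Lemma fidelity_ge n (rho sigma : 'M[C]_n) (c : R) : is_state rho -> 0 <= c ->
  psd (sigma - real_complex R c *: rho) -> Num.sqrt c <= fidelity rho sigma.
Proof.
move=> [rp rt] c0 sp.
set r := msqrt rho; have rrp : psd r by apply: psd_msqrt.
have rr : r *m r = rho by apply: msqrtK.
have cp : (0 : C) <= real_complex R c by rewrite ler0c.
have sigp : psd sigma.
  by rewrite -(subrK (real_complex R c *: rho) sigma); apply/psdD/psdZ.
have Mp (X : 'M[C]_n) : psd X -> psd (r *m X *m r).
  by move=> Xp; rewrite -{1}(psd_adjmx rrp); apply: psd_congr.
set T := real_complex R (Num.sqrt c) *: rho.
have Tp : psd T by apply: psdZ => //; rewrite ler0c sqrtr_ge0.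
have : psd (msqrt (r *m sigma *m r) - T).
  apply: (psd_sqr_monotone (psd_msqrt _) Tp).
  rewrite (msqrtK (Mp _ sigp)).
  have -> : T *m T = r *m (real_complex R c *: rho) *m r.
    rewrite /T -scalemxAl -!scalemxAr scalerA -rmorphM -expr2 sqr_sqrtr //.
    by rewrite -scalemxAl -rr !mulmxA.
  by rewrite -mulmxBl -mulmxBr; apply: (Mp _ sp).
move=> /psd_tr_ge0; rewrite linearB /= linearZ /= rt mulr1 => /ge0_ReIm[_].
by rewrite raddfB /= subr_ge0.
Qed.

(** The projector [P] onto [v] is its own root, and [P sigma P = q P] is the square of [sqrt q P],
    whose trace is [sqrt q]. *)
Lemma fidelity_pure n (v : 'cV[C]_n) (sigma : 'M[C]_n) (q : R) :
  adjmx v *m v = 1%:M -> 0 <= q ->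
  (adjmx v *m sigma *m v) 0 0 = real_complex R q ->
  fidelity (v *m adjmx v) sigma = Num.sqrt q.
Proof.
move=> vv q0 qE.
have PP : v *m adjmx v *m (v *m adjmx v) = v *m adjmx v.
  by rewrite mulmxA -(mulmxA v) vv mulmx1.
have sP : msqrt (v *m adjmx v) = v *m adjmx v.
  by rewrite -{1}PP msqrt_unique //; apply: psd_cogram.
rewrite /fidelity sP.
have -> : v *m adjmx v *m sigma *m (v *m adjmx v) =
          (real_complex R (Num.sqrt q) *: (v *m adjmx v)) *m
          (real_complex R (Num.sqrt q) *: (v *m adjmx v)).
  rewrite -scalemxAl -scalemxAr PP scalerA.
  have -> : real_complex R (Num.sqrt q) * real_complex R (Num.sqrt q) =
            (adjmx v *m sigma *m v) 0 0.
    by rewrite qE -rmorphM -expr2 sqr_sqrtr.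
  have -> : v *m adjmx v *m sigma *m (v *m adjmx v) =
            v *m (adjmx v *m sigma *m v) *m adjmx v by rewrite !mulmxA.
  by rewrite {1}(mx11_scalar (adjmx v *m sigma *m v)) mul_mx_scalar -scalemxAl.
rewrite msqrt_unique; last first.
  by apply: psdZ; [rewrite ler0c sqrtr_ge0 | exact: psd_cogram].
by rewrite linearZ /= mxtrace_mulC vv mxtrace1 mulr1.
Qed.

End PositiveSemidefinite.

(** * Entries of tensor products and partial traces, and positivity of maps on them *)

Section TensorIndices.
Variable R : realType.
Local Notation C := (R[i]).

Lemma sum_idx m n (F : 'I_(m * n) -> C) :
  \sum_x F x = \sum_i \sum_j F (idx i j).
Proof.
rewrite pair_big /= (reindex (@mxtens_index m n)) /=; last first.
  exists (@mxtens_unindex m n) => x _; rewrite ?mxtens_indexK //.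
  by rewrite mxtens_unindexK.
by apply: eq_bigr => -[i j].
Qed.

Lemma idx_eq m n (i k : 'I_m) (j l : 'I_n) :
  (idx i j == idx k l) = (i == k) && (j == l).
Proof. by rewrite (can_eq (@mxtens_indexK m n)) xpair_eqE. Qed.

Lemma idx_matrixP m n p q (X Y : 'M[C]_(m * n, p * q)) :
  (forall i j k l, X (idx i j) (idx k l) = Y (idx i j) (idx k l)) -> X = Y.
Proof.
move=> h; apply/matrixP => x y.
case: (mxtens_indexP x) => i j; case: (mxtens_indexP y) => k l; exact: h.
Qed.

Lemma tens_idxE m n p q (A : 'M[C]_(m, n)) (B : 'M[C]_(p, q)) i j k l :
  (A *t B) (idx i j) (idx k l) = A i k * B j l.
Proof. exact: tensmxE. Qed.

Lemma sum_delta (I : finType) (a : I) (F : I -> C) :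
  \sum_i (a == i)%:R * F i = F a.
Proof.
rewrite (bigD1 a) //= eqxx mul1r big1 ?addr0 // => i.
by rewrite eq_sym => /negPf ->; rewrite mul0r.
Qed.

(** The partial trace, partial transpose, swap and extension by the identity are all defined as sums
    over matrix units; their entries collapse by this rule. *)
Lemma sum_delta2 (I J : finType) (a : I) (b : J) (F : I -> J -> C) :
  \sum_i \sum_j ((a == i) && (b == j))%:R * F i j = F a b.
Proof.
under eq_bigr => i _.
  under eq_bigr => j _ do rewrite -mulnb natrM -mulrA.
  rewrite -mulr_sumr sum_delta; over.
by rewrite sum_delta.
Qed.

Lemma form_tens1 m n p q (A : 'M[C]_(m, n)) (B : 'M[C]_(p, q)) (c : nat)
    (X : 'M[C]_(n * c, p * c)) i k j l :
  ((A *t 1%:M) *m X *m (B *t 1%:M)) (idx i k) (idx j l) =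
  \sum_x \sum_y A i x * X (idx x k) (idx y l) * B y j.
Proof.
rewrite mxE sum_idx exchange_big /=.
transitivity (\sum_y \sum_x A i x * X (idx x k) (idx y l) * B y j); last first.
  by rewrite exchange_big.
rewrite exchange_big; apply: eq_bigr => y _ /=.
rewrite (bigD1 l) //= big1 => [|z zl]; last first.
  by rewrite tens_idxE [1%:M _ _]mxE (negPf zl) !mulr0.
rewrite tens_idxE [1%:M _ _]mxE eqxx mulr1 addr0 -mulr_suml; congr (_ * _).
rewrite mxE sum_idx; apply: eq_bigr => x _.
rewrite (bigD1 k) //= big1 => [|z zl]; last first.
  by rewrite tens_idxE [1%:M _ _]mxE eq_sym (negPf zl) mulr0 mul0r.
by rewrite tens_idxE [1%:M _ _]mxE eqxx mulr1 addr0.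
Qed.

Lemma adjmx_tens m n p q (A : 'M[C]_(m, n)) (B : 'M[C]_(p, q)) :
  adjmx (A *t B) = adjmx A *t adjmx B.
Proof. by rewrite /adjmx map_mxT trmx_tens. Qed.

Lemma ext_idE d n (L : 'M[C]_d -> 'M[C]_(d * d)) (X : 'M[C]_(d * n)) p k q l :
  ext_id L X (idx p k) (idx q l) = L (blk2 X k l) p q.
Proof.
rewrite summxE -[RHS](sum_delta2 k l (fun k l => L (blk2 X k l) p q)).
apply: eq_bigr => k' _; rewrite summxE; apply: eq_bigr => l' _.
by rewrite tens_idxE [delta_mx _ _ _ _]mxE mulrC.
Qed.

Lemma ptr_midE a b c (Y : 'M[C]_(a * b * c)) i k i' k' :
  ptr_mid Y (idx i k) (idx i' k') =
  \sum_j Y (idx (idx i j) k) (idx (idx i' j) k').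
Proof.
set F := RHS.
rewrite -[F]/((fun i i' k k' =>
  \sum_j Y (idx (idx i j) k) (idx (idx i' j) k')) i i' k k') /=.
rewrite -(sum_delta2 i i' (fun i i' =>
  \sum_j Y (idx (idx i j) k) (idx (idx i' j) k'))).
rewrite summxE; apply: eq_bigr => x _; rewrite summxE; apply: eq_bigr => x' _.
rewrite -(sum_delta2 k k' (fun k k' =>
  \sum_j Y (idx (idx x j) k) (idx (idx x' j) k'))) mulr_sumr.
rewrite summxE; apply: eq_bigr => y _; rewrite mulr_sumr.
rewrite summxE; apply: eq_bigr => y' _.
by rewrite mxE tens_idxE !mxE mulrC mulrA.
Qed.

Lemma ptranspose1E a b (X : 'M[C]_(a * b)) i p j q :
  ptranspose1 X (idx i p) (idx j q) = X (idx j p) (idx i q).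
Proof.
rewrite summxE -[RHS](sum_delta2 j i (fun j i => X (idx j p) (idx i q))).
apply: eq_bigr => j' _; rewrite summxE; apply: eq_bigr => i' _.
by rewrite tens_idxE !mxE andbC.
Qed.

Lemma swapWE d (i j k l : 'I_d) :
  swapW R d (idx i j) (idx k l) = ((i == l) && (j == k))%:R.
Proof.
rewrite summxE -[RHS](sum_delta2 i j (fun i' j' => ((i' == l) && (j' == k))%:R)).
apply: eq_bigr => i' _; rewrite summxE; apply: eq_bigr => j' _.
rewrite tens_idxE !mxE -!natrM !mulnb; congr (_%:R : C).
by rewrite (eq_sym k) (eq_sym l); case: (i == i'); case: (j == j'); case: eqP;
  case: eqP.
Qed.

Lemma swapW_conjE d (Y : 'M[C]_(d * d)) i j k l :
  (swapW R d *m Y *m adjmx (swapW R d)) (idx i j) (idx k l) =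
  Y (idx j i) (idx l k).
Proof.
have WY x : (swapW R d *m Y) (idx i j) x = Y (idx j i) x.
  rewrite mxE sum_idx exchange_big -[RHS](sum_delta2 i j (fun i j => Y (idx j i) x)).
  by apply: eq_bigr => a _; apply: eq_bigr => b _; rewrite swapWE.
rewrite mxE sum_idx exchange_big.
rewrite -[RHS](sum_delta2 k l (fun k l => Y (idx j i) (idx l k))).
apply: eq_bigr => a _; apply: eq_bigr => b _.
by rewrite WY adjmxE swapWE rmorph_nat mulrC.
Qed.

Lemma mxtrace_idx m n (X : 'M[C]_(m * n)) :
  \tr X = \sum_i \sum_j X (idx i j) (idx i j).
Proof. exact: sum_idx. Qed.

Lemma mxtrace_ext_id d n (L : 'M[C]_d -> 'M[C]_(d * d)) (X : 'M[C]_(d * n)) :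
  (forall Y, \tr (L Y) = \tr Y) -> \tr (ext_id L X) = \tr X.
Proof.
move=> Ltr; rewrite !mxtrace_idx exchange_big [RHS]exchange_big /=.
apply: eq_bigr => k _.
transitivity (\tr (L (blk2 X k k))).
  by apply: eq_bigr => p _; rewrite ext_idE.
by rewrite Ltr; apply: eq_bigr => i _; rewrite mxE.
Qed.

(** Each Kraus term extends to the congruence by [K i *t 1], which preserves positivity. *)
Lemma psd_ext_id_kraus d n (I : finType) (K : I -> 'M[C]_(d * d, d))
    (L : 'M[C]_d -> 'M[C]_(d * d)) (X : 'M[C]_(d * n)) :
  (forall Y, L Y = \sum_i K i *m Y *m adjmx (K i)) ->
  psd X -> psd (ext_id L X).
Proof.
move=> LE Xp.
suff -> : ext_id L X =
    \sum_i (K i *t 1%:M) *m X *m adjmx (K i *t (1%:M : 'M[C]_n)).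
  apply: psd_sum => i _.
  by have := psd_congr (adjmx (K i *t (1%:M : 'M[C]_n))) Xp; rewrite adjmxK.
apply: idx_matrixP => p k q l; rewrite ext_idE LE !summxE.
apply: eq_bigr => i _; rewrite adjmx_tens adjmx1 form_tens1 exchange_big mxE.
apply: eq_bigr => y _; rewrite mxE mulr_suml; apply: eq_bigr => x _.
by rewrite [blk2 _ _ _ _ _]mxE.
Qed.

(** The difference is half the sum over [a], [b] of [(P a - P b)^* X (P a - P b)]: since the [P a]
    sum to [1], each family of cross terms sums to [X]. *)
Lemma psd_pinching m n (P : 'I_m -> 'M[C]_n) (X : 'M[C]_n) :
  \sum_a P a = 1%:M -> psd X ->
  psd (m%:R *: (\sum_a adjmx (P a) *m X *m P a) - X).
Proof.
move=> P1 Xp.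
have -> : m%:R *: (\sum_a adjmx (P a) *m X *m P a) - X =
    2^-1 *: \sum_a \sum_b adjmx (P a - P b) *m X *m (P a - P b).
  have aP1 : \sum_a adjmx (P a) = 1%:M.
    rewrite -(adjmx1 R n) -P1.
    by apply/matrixP => i j; rewrite adjmxE !summxE rmorph_sum;
      apply: eq_bigr => a _; rewrite adjmxE.
  have cross : \sum_a \sum_b adjmx (P a) *m X *m P b = X.
    under eq_bigr => a _ do rewrite -mulmx_sumr P1 mulmx1.
    by rewrite -mulmx_suml aP1 mul1mx.
  have diag : \sum_(a < m) \sum_(b < m) adjmx (P a) *m X *m P a =
      m%:R *: \sum_a adjmx (P a) *m X *m P a.
    under eq_bigr => a _ do rewrite sumr_const card_ord -scaler_nat.
    by rewrite -scaler_sumr.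
  have -> : \sum_a \sum_b adjmx (P a - P b) *m X *m (P a - P b) =
      2 *: (m%:R *: (\sum_a adjmx (P a) *m X *m P a) - X).
    transitivity (\sum_a \sum_b
       ((adjmx (P a) *m X *m P a + adjmx (P b) *m X *m P b) -
        (adjmx (P a) *m X *m P b + adjmx (P b) *m X *m P a))).
      apply: eq_bigr => a _; apply: eq_bigr => b _.
      rewrite adjmxB mulmxBl mulmxBr !mulmxBl opprB addrACA.
      by rewrite -opprD [in RHS](addrC (adjmx (P a) *m X *m P b)).
    under eq_bigr => a _ do rewrite sumrB !big_split.
    rewrite sumrB !big_split /= diag cross.
    rewrite exchange_big /= diag [X in _ - (_ + X)]exchange_big /= cross.
    by rewrite [RHS]scaler_nat mulrnBl !mulr2n.
  by rewrite scalerA mulVf ?scale1r // pnatr_eq0.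
apply: psdZ; first by rewrite invr_ge0 ler0n.
by apply: psd_sum => a _; apply: psd_sum => b _; apply: psd_congr.
Qed.

(** With [E x a] equal to [|x><a|] tensor the identity, [1 *t ptr1 X] is the sum over all [a], [x]
    of the congruences of [X] by [E x a]. *)
Lemma psd_ptr1_dominates m n (X : 'M[C]_(m * n)) : psd X ->
  psd (m%:R *: ((1%:M : 'M[C]_m) *t ptr1 X) - X).
Proof.
move=> Xp.
pose E (x a : 'I_m) : 'M[C]_(m * n) := delta_mx x a *t 1%:M.
have -> : (1%:M : 'M[C]_m) *t ptr1 X =
    \sum_a \sum_x adjmx (E x a) *m X *m E x a.
  apply: idx_matrixP => b k b' l; rewrite tens_idxE summxE.
  rewrite !mxE mulr_sumr.
  under [RHS]eq_bigr => a _ do rewrite summxE.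
  rewrite exchange_big /=; apply: eq_bigr => x _.
  transitivity (\sum_a (b == a)%:R * ((a == b')%:R * X (idx x k) (idx x l))).
    by rewrite sum_delta.
  apply: eq_bigr => a _.
  rewrite /E adjmx_tens adjmx1 form_tens1 adjmx_delta.
  rewrite -[LHS](sum_delta2 x x (fun y z =>
     (b == a)%:R * ((a == b')%:R * X (idx y k) (idx z l)))).
  apply: eq_bigr => y _; apply: eq_bigr => z _; rewrite !mxE.
  rewrite (eq_sym x) (eq_sym x) (eq_sym b').
  by case: (b == a); case: (y == x); case: (z == x); case: (a == b');
    rewrite /= ?(mul0r, mulr0, mul1r, mulr1).
(* The terms [x = a] form a pinching, which already dominates [X] after scaling by [m]; the
   remaining terms add a psd matrix. *)
have -> : \sum_a \sum_x adjmx (E x a) *m X *m E x a =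
    \sum_a adjmx (E a a) *m X *m E a a +
    \sum_a \sum_(x | x != a) adjmx (E x a) *m X *m E x a.
  by rewrite -big_split; apply: eq_bigr => a _; rewrite (bigD1 a).
rewrite scalerDr addrAC; apply: psdD.
  apply: psd_pinching => //.
  apply: idx_matrixP => b k b' l; rewrite summxE mxE idx_eq.
  transitivity (\sum_a (b == a)%:R * ((b' == a) && (k == l))%:R : C).
    by apply: eq_bigr => a _; rewrite tens_idxE !mxE -!natrM !mulnb andbA.
  by rewrite sum_delta (eq_sym b').
apply: psdZ; first by rewrite ler0n.
by apply: psd_sum => a _; apply: psd_sum => x _; apply: psd_congr.
Qed.

End TensorIndices.

(** * The channel [Upsilon]: Kraus form, symmetry and marginal *)

Section Cloner.
Variable R : realType.
Local Notation C := (R[i]).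

(** The Choi vector reshaped into an operator from A to A1 A2; unlike [K_i] in the overview, it
    carries the normalization of [ups_v]. *)
Definition ups_kraus d (i : 'I_d) : 'M[C]_(d * d, d) :=
  \matrix_(p, j) ups_v R i (idx j p) 0.

Lemma ketE d (i x : 'I_d) y : ket R i x y = (x == i)%:R.
Proof. by rewrite mxE ord1 eqxx andbT. Qed.

(** Only the row index is split: for products of kets the column index is not presented as an
    [idx]. *)
Lemma tens_idx_lE m n p q (A : 'M[C]_(m, n)) (B : 'M[C]_(p, q)) i j y :
  (A *t B) (idx i j) y = A i (mxtens_unindex y).1 * B j (mxtens_unindex y).2.
Proof. by rewrite mxE mxtens_indexK. Qed.

Lemma ups_krausE d (i a b j : 'I_d) :
  ups_kraus i (idx a b) j = real_complex R (Num.sqrt (2 * (d%:R + 1)))^-1 *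
    ((i == a)%:R * (j == b)%:R + (i == b)%:R * (j == a)%:R).
Proof.
rewrite mxE mxE; congr (_ * _).
rewrite mxE summxE [X in X + _]mxE !tens_idx_lE !ketE.
have T k : (ket R k *t (ket R i *t ket R k + ket R k *t ket R i))
    (idx j (idx a b)) 0 =
    (j == k)%:R * ((a == i)%:R * (b == k)%:R + (a == k)%:R * (b == i)%:R).
  by rewrite tens_idx_lE ketE mxE !tens_idx_lE !ketE.
under eq_bigr => k _ do rewrite T.
(* The separate term [2 |i>|ii>] is exactly what [k = i] contributes to the unrestricted sum. *)
transitivity (\sum_k (j == k)%:R * ((a == i)%:R * (b == k)%:R +
    (a == k)%:R * (b == i)%:R) : C).
  rewrite [RHS](bigD1 i) //=; congr (_ + _); ring.
rewrite sum_delta (eq_sym a i) (eq_sym b i) (eq_sym a) (eq_sym b); ring.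
Qed.

(** The partial transpose makes entry [(p, q)] the sum of [J (j', p) (j, q) rho j' j] over [j],
    [j']; each rank-one term of the Choi matrix [J] then becomes one Kraus term. *)
Lemma UpsilonE d (rho : 'M[C]_d) :
  Upsilon rho = \sum_i ups_kraus i *m rho *m adjmx (ups_kraus i).
Proof.
apply/matrixP => p q; rewrite mxE.
under eq_bigr => j _.
  rewrite mxE sum_idx.
  under eq_bigr => j' _.
    under eq_bigr => x _ do rewrite ptranspose1E tens_idxE [1%:M _ _]mxE.
    under eq_bigr => x _ do rewrite (mulrCA _ (rho _ _)) mulrA mulrC eq_sym.
    rewrite sum_delta; over.
  over.
rewrite summxE.
transitivity (\sum_i \sum_j \sum_j'
   rho j' j * (ups_kraus i p j' * (ups_kraus i q j)^*)).
  rewrite [RHS]exchange_big /=; apply: eq_bigr => j _.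
  rewrite [RHS]exchange_big /=; apply: eq_bigr => j' _.
  rewrite summxE mulr_sumr; apply: eq_bigr => i _; congr (_ * _).
  by rewrite [LHS]mxE big_ord1 adjmxE [ups_kraus _ _ j']mxE [ups_kraus _ _ j]mxE.
apply: eq_bigr => i _; rewrite mxE; apply: eq_bigr => j _.
rewrite [(_ *m rho) _ _]mxE mulr_suml; apply: eq_bigr => j' _.
rewrite adjmxE; ring.
Qed.

Lemma ups_norm_sqr d :
  (real_complex R (Num.sqrt (2 * (d%:R + 1)))^-1) ^+ 2 = (2 * (d%:R + 1))^-1.
Proof.
rewrite -rmorphXn exprVn sqr_sqrtr; last first.
  by rewrite mulr_ge0 ?addr_ge0 ?ler0n.
by rewrite !natr1 -!natrM fmorphV rmorph_nat.
Qed.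

(** Each Kraus entry is real with two delta terms, whence four terms. Trace preservation, swap
    invariance and the marginal are all read off this formula. *)
Lemma Upsilon_entry d (rho : 'M[C]_d) a b a' b' :
  Upsilon rho (idx a b) (idx a' b') = (2 * (d%:R + 1))^-1 *
    ((a == a')%:R * rho b b' + (a == b')%:R * rho b a' +
     ((b == a')%:R * rho a b' + (b == b')%:R * rho a a')).
Proof.
rewrite UpsilonE summxE -ups_norm_sqr.
set s := real_complex R _.
have KJ (i : 'I_d) p l :
    (ups_kraus i (idx p.1 p.2) l)^* = ups_kraus i (idx p.1 p.2) l.
  apply/CrealP; rewrite ups_krausE rpredM //; last first.
    by rewrite rpredD // rpredM // realn.
  by apply/complex_realP; exists (Num.sqrt (2 * (d%:R + 1)))^-1.
have KE i l : (ups_kraus i *m rho) (idx a b) l =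
    s * ((i == a)%:R * rho b l + (i == b)%:R * rho a l).
  rewrite mxE.
  under eq_bigr => j _ do rewrite ups_krausE -/s -mulrA mulrDl -!mulrA
     (eq_sym j) (eq_sym j).
  rewrite -mulr_sumr big_split /= -!mulr_sumr.
  by rewrite (sum_delta b (fun j => rho j l)) (sum_delta a (fun j => rho j l)).
have KKE i : (ups_kraus i *m rho *m adjmx (ups_kraus i)) (idx a b) (idx a' b') =
    s ^+ 2 * ((a == i)%:R * ((i == a')%:R * rho b b' + (i == b')%:R * rho b a') +
       (b == i)%:R * ((i == a')%:R * rho a b' + (i == b')%:R * rho a a')).
  rewrite mxE.
  under eq_bigr => l _ do rewrite adjmxE (KJ _ (a', b')) ups_krausE -/s KE
     (eq_sym l) (eq_sym l).
  pose F l := s ^+ 2 * ((i == a)%:R * rho b l + (i == b)%:R * rho a l).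
  transitivity ((i == a')%:R * (\sum_l (b' == l)%:R * F l) +
                (i == b')%:R * (\sum_l (a' == l)%:R * F l)).
    rewrite !mulr_sumr -big_split; apply: eq_bigr => l _; rewrite /F /=; ring.
  rewrite !sum_delta /F (eq_sym a) (eq_sym b); ring.
under eq_bigr => i _ do rewrite KKE.
rewrite -mulr_sumr big_split /=.
rewrite (sum_delta a (fun i => (i == a')%:R * rho b b' + (i == b')%:R * rho b a')).
by rewrite (sum_delta b (fun i => (i == a')%:R * rho a b' + (i == b')%:R * rho a a')).
Qed.

Lemma two_succ_neq0 d : 2 * (d%:R + 1) != 0 :> C.
Proof. by rewrite mulf_neq0 ?pnatr_eq0 // natr1 pnatr_eq0. Qed.

Lemma sum_constE n (x : C) : \sum_(i < n) x = n%:R * x.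
Proof. by rewrite sumr_const card_ord mulr_natl. Qed.

Lemma Upsilon_sym_broadcast d : sym_broadcast (@Upsilon R d).
Proof.
split; first split.
- move=> c X Y; rewrite !UpsilonE scaler_sumr -big_split.
  by apply: eq_bigr => i _; rewrite mulmxDr mulmxDl -scalemxAr -scalemxAl.
- by move=> n X; apply: psd_ext_id_kraus; apply: UpsilonE.
- move=> X; rewrite mxtrace_idx.
  (* Summing the diagonal over [b] first leaves these four terms; their sum over [a] is
     [2 (d + 1) tr X]. *)
  transitivity ((2 * (d%:R + 1))^-1 *
    \sum_(a < d) (\tr X + X a a + (X a a + d%:R * X a a))).
    rewrite mulr_sumr; apply: eq_bigr => a _.
    under eq_bigr => b _ do rewrite Upsilon_entry !eqxx !mul1r.
    rewrite -mulr_sumr !big_split /=; congr (_ * (_ + _ + (_ + _))).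
    + by rewrite (sum_delta a (fun b => X b a)).
    + by under eq_bigr => b _ do rewrite eq_sym; rewrite (sum_delta a (X a)).
    + by rewrite sum_constE.
  rewrite !big_split /= -mulr_sumr sum_constE -/(\tr X).
  by apply: (mulfI (two_succ_neq0 d)); rewrite mulrA divff ?two_succ_neq0 //; ring.
- move=> rho _; apply: idx_matrixP => a b a' b'.
  rewrite swapW_conjE !Upsilon_entry; congr (_ * _); ring.
Qed.

(** Tracing out A2 turns the four terms of the entry formula into [1 *t ptr1 X], [X], [X] and
    [d X]. *)
Lemma Upsilon_marginal d n (X : 'M[C]_(d * n)) :
  ptr_mid (ext_id (@Upsilon R d) X) =
  (2 * (d%:R + 1))^-1 *: ((1%:M : 'M[C]_d) *t ptr1 X + (d%:R + 2) *: X).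
Proof.
apply: idx_matrixP => a k a' l; rewrite ptr_midE.
under eq_bigr => b _ do
  rewrite ext_idE Upsilon_entry eqxx mul1r ![blk2 _ _ _ _ _]mxE.
rewrite -mulr_sumr !big_split /= -mulr_sumr.
rewrite (sum_delta a (fun b => X (idx b k) (idx a' l))).
under [X in _ + (X + _)]eq_bigr => b _ do rewrite eq_sym.
rewrite (sum_delta a' (fun b => X (idx a k) (idx b l))) sum_constE.
rewrite [RHS]mxE [X in _ = _ * X]mxE tens_idxE [1%:M _ _]mxE [ptr1 _ _ _]mxE.
rewrite [X in _ = _ * (_ + X)]mxE; congr (_ * _); ring.
Qed.

(** Since [(d + 2) / (2 (d + 1)) - (d + 1) / (2 d) = - 1 / (2 d (d + 1))], the difference is a
    positive multiple of [d (1 *t ptr1 X) - X]. *)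
Lemma Upsilon_marginal_dominates d n (X : 'M[C]_(d * n)) : (0 < d)%N -> psd X ->
  psd (ptr_mid (ext_id (@Upsilon R d) X) -
       real_complex R ((d%:R + 1) / (2 * d%:R)) *: X).
Proof.
move=> d0 Xp; have dn0 : d%:R != 0 :> C by rewrite pnatr_eq0 -lt0n.
have d1n0 : d%:R + 1 != 0 :> C by rewrite natr1 pnatr_eq0.
have -> : ptr_mid (ext_id (@Upsilon R d) X) -
          real_complex R ((d%:R + 1) / (2 * d%:R)) *: X =
    (2 * (d%:R + 1) * d%:R)^-1 *: (d%:R *: ((1%:M : 'M[C]_d) *t ptr1 X) - X).
  rewrite Upsilon_marginal scalerDr scalerBr !scalerA -addrA -scalerBl.
  have -> : real_complex R ((d%:R + 1) / (2 * d%:R)) = (d%:R + 1) / (2 * d%:R).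
    by rewrite !natr1 -!natrM rmorphM fmorphV !rmorph_nat.
  congr (_ *: _ + _); first by field; rewrite dn0 d1n0.
  by rewrite -scaleNr; congr (_ *: _); field; rewrite dn0 d1n0.
apply: psdZ; last exact: psd_ptr1_dominates.
by rewrite invr_ge0 !mulr_ge0 ?addr_ge0 ?ler0n.
Qed.

End Cloner.

(** * The upper bound from the maximally entangled state *)

Section UpperBound.
Variable R : realType.
Local Notation C := (R[i]).

(** States span all matrices: rescaling reaches every [v v^*], and polarization with [a = 1] and
    [a = i] then reaches the matrix units. *)
Lemma linear_eq0_states d m (f : 'M[C]_d -> 'M[C]_m) :
  (forall c X Y, f (c *: X + Y) = c *: f X + f Y) ->
  (forall rho, is_state rho -> f rho = 0) -> forall X, f X = 0.
Proof.
move=> fl fs.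
have fD X Y : f (X + Y) = f X + f Y by rewrite -[X]scale1r fl !scale1r.
have f0 : f 0 = 0 by apply/(addIr (f 0)); rewrite -fD !add0r.
have fZ c X : f (c *: X) = c *: f X by rewrite -[c *: X]addr0 fl f0 addr0.
have fv (v : 'cV[C]_d) : f (v *m adjmx v) = 0.
  have vp := psd_cogram v; set X := v *m adjmx v in vp *.
  have [tX0|tXn0] := eqVneq (\tr X) 0.
    rewrite /X; suff -> : v = 0 by rewrite mul0mx f0.
    apply/matrixP => i j; rewrite ord1 mxE.
    have XE k : X k k = `|v k 0| ^+ 2.
      by rewrite mxE big_ord1 adjmxE normCK.
    move/eqP: tX0; rewrite psumr_eq0 => [/allP/(_ i (mem_index_enum i))|k _].
      by rewrite XE sqrf_eq0 normr_eq0 => /eqP.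
    by rewrite XE exprn_ge0.
  rewrite -[X]scale1r -(divff tXn0) -scalerA fZ fs ?scaler0 //; split.
    by apply: psdZ => //; rewrite invr_ge0 psd_tr_ge0.
  by rewrite linearZ /= mulVf.
have fE k l : f (delta_mx k l) = 0.
  pose u : 'cV[C]_d := delta_mx k 0; pose w : 'cV[C]_d := delta_mx l 0.
  have -> : delta_mx k l = u *m adjmx w.
    by rewrite adjmx_delta mul_delta_mx.
  have E a : a^* *: f (u *m adjmx w) + a *: f (w *m adjmx u) = 0.
    have := fv (u + a *: w); rewrite adjmxD adjmxZ mulmxDl !mulmxDr.
    by rewrite -!(scalemxAl, scalemxAr) !fD !fZ !fv !scaler0 add0r addr0.
  have := E 1; have := E 'i; rewrite conjCi rmorph1 !scale1r.
  rewrite scaleNr => /eqP.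
  rewrite addrC subr_eq0 => /eqP/(scalerI (neq0Ci _)) -> /eqP.
  by rewrite -mulr2n -scaler_nat scaler_eq0 pnatr_eq0 => /= /eqP.
move=> X; rewrite (matrix_sum_delta X).
have fsum (I : finType) (F : I -> 'M[C]_d) : f (\sum_i F i) = \sum_i f (F i).
  by elim/big_ind2: _ => // a b c e <- <-.
by rewrite fsum big1 // => i _; rewrite fsum big1 // => j _; rewrite fZ fE scaler0.
Qed.

(* With M = V V^* + U U^* and D = V - U one has M^2 = (1 + c) M - c D D^*, so
   1 - M / (1 + c) = (1 - M / (1 + c))^2 + c / (1 + c)^2 D D^*. *)
Lemma psd_isometry_pair m n (V U : 'M[C]_(m, n)) (c : C) : 0 <= c ->
  adjmx V *m V = 1%:M -> adjmx U *m U = 1%:M ->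
  adjmx V *m U = c%:M -> adjmx U *m V = c%:M ->
  psd ((1 + c)%:M - (V *m adjmx V + U *m adjmx U)).
Proof.
move=> c0 VV UU VU UV; set M := V *m adjmx V + U *m adjmx U.
have c1 : 1 + c != 0 by rewrite gt_eqF // ltr_pwDl.
pose D := V - U; pose l := (1 + c)^-1.
have MM : M *m M = (1 + c) *: M - c *: (D *m adjmx D).
  rewrite /M /D mulmxDl !mulmxDr !mulmxA.
  rewrite -!(mulmxA _ (adjmx _) V) -!(mulmxA _ (adjmx _) U) VV UU VU UV.
  rewrite !mulmx1 !mul_mx_scalar -!scalemxAl adjmxB mulmxBl !mulmxBr.
  rewrite scalerDl scale1r !scalerBr !scalerDr.
  move: (V *m adjmx V) (U *m adjmx U) (V *m adjmx U) (U *m adjmx V).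
  by move=> A B E F; apply/matrixP => i j; rewrite !mxE; ring.
have Mh : adjmx M = M by rewrite adjmxD !adjmxM !adjmxK.
have l0 : 0 <= l by rewrite invr_ge0 addr_ge0.
have Nh : adjmx (1%:M - l *: M) = 1%:M - l *: M.
  have lJ : l^* = l by apply/CrealP/ger0_real.
  by rewrite adjmxB adjmxZ Mh lJ adjmx1.
have -> : (1 + c)%:M - M = (1 + c) *:
    (adjmx (1%:M - l *: M) *m (1%:M - l *: M) + (c * l ^+ 2) *: (D *m adjmx D)).
  rewrite Nh mulmxBr mulmx1 mulmxBl mul1mx -scalemxAl -scalemxAr MM.
  rewrite -[(1 + c)%:M]scalemx1.
  move: (D *m adjmx D) M {MM Mh Nh} => DD M.
  by apply/matrixP => i j; rewrite /l !mxE; field.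
apply: psdZ; first by rewrite addr_ge0.
apply: psdD; first exact: psd_gram.
by apply: psdZ; [rewrite mulr_ge0 ?exprn_ge0 | exact: psd_cogram].
Qed.

(** One format for the maximally entangled vector and for the isometries [V] and [U] of the upper
    bound, so that their products and forms all reduce to double sums over [g]. *)
Definition uniform_superposition d n N (g : 'I_n -> 'I_d -> 'I_N) : 'M[C]_(N, n) :=
  \matrix_(x, j) (sqrtC d%:R^-1 * \sum_(k < d) (g j k == x)%:R).

Lemma mulmx_uniform_superposition d n N m (g : 'I_n -> 'I_d -> 'I_N)
    (X : 'M[C]_(m, N)) x j :
  (X *m uniform_superposition g) x j = sqrtC d%:R^-1 * \sum_k X x (g j k).
Proof.
rewrite mxE mulr_sumr.
transitivity (\sum_y \sum_k (g j k == y)%:R * (sqrtC d%:R^-1 * X x y)).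
  by apply: eq_bigr => y _; rewrite mxE mulrCA !mulr_sumr;
    apply: eq_bigr => k _; rewrite mulrA mulrC.
rewrite exchange_big; apply: eq_bigr => k _.
by rewrite (sum_delta (g j k) (fun y => sqrtC d%:R^-1 * X x y)).
Qed.

Lemma uniform_superposition_form d n n' N (g : 'I_n -> 'I_d -> 'I_N)
    (h : 'I_n' -> 'I_d -> 'I_N) (X : 'M[C]_N) i j :
  (adjmx (uniform_superposition g) *m X *m uniform_superposition h) i j =
  d%:R^-1 * \sum_k \sum_l X (g i k) (h j l).
Proof.
set r : C := sqrtC d%:R^-1.
have rJ : r^* = r.
  by apply/CrealP/ger0_real; rewrite sqrtC_ge0 invr_ge0 ler0n.
rewrite -mulmxA; set Y := X *m _.
(* Passing to adjoints puts the superposition on the right, where the product formula applies. *)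
have -> : adjmx (uniform_superposition g) *m Y =
          adjmx (adjmx Y *m uniform_superposition g) by rewrite adjmxM adjmxK.
rewrite adjmxE mulmx_uniform_superposition -/r rmorphM rmorph_sum /= rJ.
rewrite -(sqrtCK d%:R^-1) -/r expr2 -mulrA; congr (_ * _).
rewrite mulr_sumr; apply: eq_bigr => k _.
by rewrite adjmxE conjCK mulmx_uniform_superposition.
Qed.

Lemma uniform_superposition_gram d n n' N (g : 'I_n -> 'I_d -> 'I_N)
    (h : 'I_n' -> 'I_d -> 'I_N) i j :
  (adjmx (uniform_superposition g) *m uniform_superposition h) i j =
  d%:R^-1 * \sum_k \sum_l (g i k == h j l)%:R.
Proof.
rewrite -[adjmx _]mulmx1 uniform_superposition_form; congr (_ * _).
by apply: eq_bigr => k _; apply: eq_bigr => l _; rewrite mxE.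
Qed.

Lemma sum_diag_delta d (b : bool) : \sum_(k < d) \sum_(l < d)
  ((k == l) && b)%:R = d%:R * b%:R :> C.
Proof.
rewrite -sum_constE; apply: eq_bigr => k _.
under eq_bigr => l _ do rewrite -mulnb natrM.
by rewrite (sum_delta k (fun=> b%:R)).
Qed.

Definition max_entangled d : 'cV[C]_(d * d) :=
  uniform_superposition (fun (_ : 'I_1) (k : 'I_d) => idx k k).

Lemma max_entangled_unit d : (0 < d)%N ->
  adjmx (max_entangled d) *m max_entangled d = 1%:M.
Proof.
move=> d0; apply/matrixP => i j; rewrite uniform_superposition_gram mxE !ord1.
under eq_bigr => k _ do under eq_bigr => l _ do rewrite idx_eq andbb -[_ == _]andbT.
by rewrite sum_diag_delta mulr1 mulVf // pnatr_eq0 -lt0n.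
Qed.

Lemma max_entangled_state d : (0 < d)%N ->
  is_state (max_entangled d *m adjmx (max_entangled d)).
Proof.
move=> d0; split; first exact: psd_cogram.
by rewrite mxtrace_mulC max_entangled_unit // mxtrace1.
Qed.

Lemma max_entangled_fidelity_le d (L : 'M[C]_d -> 'M[C]_(d * d)) :
  (0 < d)%N -> sym_broadcast L ->
  fidelity (max_entangled d *m adjmx (max_entangled d))
    (ptr_mid (ext_id L (max_entangled d *m adjmx (max_entangled d)))) <=
  Num.sqrt ((d%:R + 1) / (2 * d%:R)).
Proof.
move=> d0 [[Ll Lcp Ltr] Ls].
set rho := max_entangled d *m adjmx (max_entangled d).
have dn0 : d%:R != 0 :> C by rewrite pnatr_eq0 -lt0n.
have [rp rt] := max_entangled_state d0; rewrite -/rho in rp rt.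
set J := ext_id L rho; have Jp : psd J by apply: Lcp.
have Jt : \tr J = 1 by rewrite mxtrace_ext_id.
(* The entries of [J] involve [L] on blocks of [rho], which need not be states, so swap invariance
   is first extended by linearity. *)
have LW X : L X = swapW R d *m L X *m adjmx (swapW R d).
  apply/eqP; rewrite -subr_eq0; apply/eqP; move: X.
  apply: (@linear_eq0_states _ _
    (fun X => L X - swapW R d *m L X *m adjmx (swapW R d))).
    move=> c X Y; rewrite Ll mulmxDr mulmxDl -scalemxAr -scalemxAl scalerBr.
    by rewrite opprD addrACA.
  by move=> X /Ls LX; rewrite -LX subrr.
have Jsym a b k a' b' l : J (idx (idx a b) k) (idx (idx a' b') l) =
    J (idx (idx b a) k) (idx (idx b' a') l).
  by rewrite !ext_idE [in LHS]LW swapW_conjE.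
(* Indices are ordered A1, A2, B. Column [j] of [V] entangles A1 with B and puts A2 in [|j>]; [U]
   exchanges the roles of A1 and A2. *)
pose V := uniform_superposition (fun j k : 'I_d => idx (idx k j) k).
pose U := uniform_superposition (fun j k : 'I_d => idx (idx j k) k).
set q := (adjmx (max_entangled d) *m ptr_mid J *m max_entangled d) 0 0.
(* The traced-out index of A2 is the column index of [V]. *)
have qV : q = \tr (adjmx V *m J *m V).
  rewrite /q uniform_superposition_form.
  under [RHS]eq_bigr => j _ do rewrite uniform_superposition_form.
  rewrite -mulr_sumr; congr (_ * _).
  rewrite [RHS]exchange_big; apply: eq_bigr => k _.
  by rewrite [RHS]exchange_big; apply: eq_bigr => l _; rewrite ptr_midE.
have qU : q = \tr (adjmx U *m J *m U).
  rewrite qV; apply: eq_bigr => j _; rewrite !uniform_superposition_form.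
  congr (_ * _); apply: eq_bigr => k _; apply: eq_bigr => l _; exact: Jsym.
have q0 : 0 <= q by rewrite qV; apply/psd_tr_ge0/psd_congr.
have VV : adjmx V *m V = 1%:M.
  apply/matrixP => i j; rewrite uniform_superposition_gram mxE.
  under eq_bigr => k _ do under eq_bigr => l _ do rewrite !idx_eq andbAC andbb.
  by rewrite sum_diag_delta mulrA mulVf // mul1r.
have UU : adjmx U *m U = 1%:M.
  apply/matrixP => i j; rewrite uniform_superposition_gram mxE.
  under eq_bigr => k _ do under eq_bigr => l _ do
    rewrite !idx_eq -andbA andbb andbC.
  by rewrite sum_diag_delta mulrA mulVf // mul1r.
(* The vectors [|k i k>] and [|j l l>] agree only for [k = j = l = i], so one term of weight [1/d]
   survives, and only when [i = j]. *)
have VU : adjmx V *m U = (d%:R^-1)%:M.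
  apply/matrixP => i j; rewrite uniform_superposition_gram mxE -[RHS]mulr_natr.
  congr (_ * _).
  transitivity (\sum_k \sum_l ((j == k) && (i == l))%:R * (k == l)%:R : C).
    apply: eq_bigr => k _; apply: eq_bigr => l _.
    by rewrite !idx_eq -natrM mulnb (eq_sym k j).
  by rewrite (sum_delta2 j i (fun k l => (k == l)%:R)) eq_sym.
have UV : adjmx U *m V = (d%:R^-1)%:M.
  rewrite -[V]adjmxK -adjmxM VU.
  by apply/matrixP => i j; rewrite adjmxE !mxE eq_sym rmorphMn fmorphV rmorph_nat.
have ci0 : 0 <= d%:R^-1 :> C by rewrite invr_ge0 ler0n.
have Zp := psd_isometry_pair ci0 VV UU VU UV.
have qle : q <= (d%:R + 1) / (2 * d%:R).
  (* With [tr J = 1] and both projections having expectation [q], this reads [2 q <= 1 + 1/d]. *)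
  have := psd_mxtrace_mul_ge0 Jp Zp.
  rewrite mulmxBr mul_mx_scalar mulmxDr linearB linearZ linearD /= Jt mulr1.
  rewrite !(mulmxA J) (mxtrace_mulC (J *m V)) (mxtrace_mulC (J *m U)) !mulmxA.
  rewrite -qV -qU -mulr2n subr_ge0 => h.
  rewrite -(ler_pM2l (x := 2)) ?ltr0n // [2 * q]mulr_natl; apply: le_trans h _.
  rewrite le_eqVlt; apply/orP; left; apply/eqP; field.
  by rewrite dn0.
have qE : q = real_complex R (complex.Re q) by rewrite RRe_real // ger0_real.
have cE : (d%:R + 1) / (2 * d%:R) = real_complex R ((d%:R + 1) / (2 * d%:R)) :> C.
  by rewrite !natr1 -!natrM rmorphM fmorphV !rmorph_nat.
rewrite (fidelity_pure (max_entangled_unit d0) _ qE); last first.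
  by case/ge0_ReIm: q0.
by apply: ler_wsqrtr; rewrite -lecR -qE -cE.
Qed.

End UpperBound.

(* max over symmetric broadcasting channels of P is attained at Upsilon^d *)
Theorem theorem3 (R : realType) (d : nat) (hd : (2 <= d)%N) :
  sym_broadcast (@Upsilon R d) /\
  (forall L : 'M[R[i]]_d -> 'M[R[i]]_(d * d),
      sym_broadcast L -> broadcast_power L <= broadcast_power (@Upsilon R d)).
Proof.
have d0 : (0 < d)%N by apply: ltnW.
split; first exact: Upsilon_sym_broadcast.
move=> L Ls; apply: (@le_trans _ _ (Num.sqrt ((d%:R + 1) / (2 * d%:R)))).
  apply: le_trans (max_entangled_fidelity_le d0 Ls).
  (* The infimum is bounded by the value at the maximally entangled state because the fidelities are
     bounded below by [0]. *)
  apply: ge_inf; last by eexists; [exact: max_entangled_state | reflexivity].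
  by exists 0 => _ [rho _ <-]; apply: fidelity_ge0.
(* A lower bound of the values passes to [inf] once the set is nonempty; the same state witnesses
   this. *)
apply: lb_le_inf; first by eexists; eexists; [exact: max_entangled_state |].
move=> _ [rho [rp rt] <-]; apply: fidelity_ge => //.
  by rewrite divr_ge0 ?mulr_ge0 ?addr_ge0 ?ler0n.
exact: Upsilon_marginal_dominates.
Qed.
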